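(* For any polynomial $q\colon\mathbb C\to\mathbb C$, with $f_n(z)=z^n+q(z)$, \[K_{\infty}=K_q\cup\bigcup_{j=0}^{\infty}S_j\ \supset\ \overline{\lim}_{n\to\infty}K(f_n)\ \supset\ \underline{\lim}_{n\to\infty}K(f_n)\ \supset\ \partial K_q\cup\bigcup_{j=0}^{\infty}S_j.\]
   Context: For a polynomial $q$ and a positive integer $n$, $f_n\colon\mathbb C\to\mathbb C$ is $f_n(z)=z^n+q(z)$. The filled Julia set $K(f)$ of $f\colon\mathbb C\to\mathbb C$ is the set of points of $\mathbb C$ whose orbit under iteration of $f$ is bounded. $q^k$ denotes the $k$-th iterate of $q$ ($q^0$ is the identity). Define $K_q=\{z\in\mathbb C: |q^k(z)|<1\text{ for all }k\ge 0\}$ and, for each integer $j\ge 0$, $S_j=\{z\in\mathbb C: |q^j(z)|=1\text{ and }|q^i(z)|<1\text{ for all }0\le i<j\}$; in particular $S_0$ is the unit circle. Define $K_\infty=K_q\cup\bigcup_{j\ge0}S_j$. $\partial$ denotes topological boundary in $\mathbb C$. For a sequence of sets $A_n\subset\mathbb C$, the Painlevé–Kuratowski lower and upper limits are $\underline{\lim}_{n\to\infty}A_n=\{z\in\mathbb C:\limsup_{n\to\infty}d(z,A_n)=0\}$ and $\overline{\lim}_{n\to\infty}A_n=\{z\in\mathbb C:\liminf_{n\to\infty}d(z,A_n)=0\}$, where $d(z,A)=\inf_{a\in A}|z-a|$. The symbol $\supset$ allows equality.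
   Formalization: The last inclusion (the lower limit contains ∂K_q and all S_j) is stated only for q not a constant of modulus 1; for q = c with |c| = 1 it is false, since S_1 is the whole open unit disc while 0 is not in the lower limit. *)

(* Defs.v *)
From mathcomp Require Import all_boot all_order all_algebra.
From mathcomp Require Import complex.
From mathcomp Require Import all_classical all_reals all_analysis.

Set Implicit Arguments.
Unset Strict Implicit.
Unset Printing Implicit Defensive.

Import Order.TTheory GRing.Theory Num.Theory.
Import numFieldNormedType.Exports.

Local Open Scope classical_set_scope.
Local Open Scope ring_scope.
Local Open Scope complex_scope.

Section Definitions.
Variable R : realType.
Implicit Types (q : {poly R[i]}) (f : R[i] -> R[i]) (z : R[i]) (A : set R[i]).

Definition power_plus q (n : nat) : R[i] -> R[i] := fun z => z ^+ n + q.[z].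

(* In R[i] the order is partial: `|w| <= M forces M to be real. *)
Definition filled_julia f : set R[i] :=
  [set z | exists M : R[i], forall k : nat, `|iter k f z| <= M].

Definition K_ q : set R[i] :=
  [set z | forall k : nat, `|iter k (horner q) z| < 1].

Definition S_ q (j : nat) : set R[i] :=
  [set z | `|iter j (horner q) z| = 1 /\
           forall i : nat, (i < j)%N -> `|iter i (horner q) z| < 1].

Definition K_infty q : set R[i] := K_ q `|` \bigcup_j S_ q j.

(* The norm of R[i] takes values in R[i] and is real, hence Re. The value is
   extended real, so that the distance to the empty set is +oo and not 0. *)
Definition dist_set z A : \bar R :=
  ereal_inf [set (complex.Re `|z - a|)%:E | a in A].

Definition PK_liminf (A_ : nat -> set R[i]) : set R[i] :=
  [set z | limn_esup (fun n => dist_set z (A_ n)) = 0%E].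

Definition PK_limsup (A_ : nat -> set R[i]) : set R[i] :=
  [set z | limn_einf (fun n => dist_set z (A_ n)) = 0%E].

(* The alias R[i]^o carries the topology defined by the modulus. *)
Definition frontier (A : set R[i]) : set R[i] :=
  closure (A : set R[i]^o) `\` interior (A : set R[i]^o).

End Definitions.

(* Main.v *)
Require Import Defs.
From mathcomp Require Import all_boot all_order all_algebra.
From mathcomp Require Import complex.
From mathcomp Require Import all_classical all_reals all_analysis.
From mathcomp Require Import ring lra zify.

(** Upper limit: if [|q^j(z)| > 1] while the earlier iterates lie in the open
    disc, then [f_n^j -> q^j] uniformly near [z], so [f_n^j] maps a neighborhood
    of [z] into [|u| > 1 + h], where every point escapes once [n] is large.

    Lower limit: a zero of [z^n + q(z) - z] is fixed by [f_n], and zeros of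
    [z^n + p(z)] accumulate on the whole unit circle, so [S_0] is approached by
    points of [K(f_n)].  Since [f_n -> q] on the open disc, a Hurwitz argument
    pulls approximations back along [q], which yields all the [S_j].  Finally a
    segment joining a point of [K_q] to a point outside meets some [S_j], so the
    union of the [S_j] accumulates at each boundary point of [K_q].

    The complex analysis is done on the factorization of a polynomial over its
    roots: a value of [F'/F] of modulus above [deg F / d] forces a root within
    distance [d], and products over roots of unity replace the minimum modulus
    principle. *)

Set Implicit Arguments.
Unset Strict Implicit.
Unset Printing Implicit Defensive.

Import numFieldNormedType.Exports.
Import Order.TTheory GRing.Theory Num.Theory ComplexField.Normc.

Local Open Scope classical_set_scope.
Local Open Scope ring_scope.
Local Open Scope complex_scope.

(** * The real-valued modulus on [R[i]] *)

Lemma normr_normc (R : rcfType) (z : R[i]) : `|z| = (normc z)%:C.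
Proof. by case: z. Qed.

Lemma normc_ge0 (R : rcfType) (z : R[i]) : 0 <= normc z.
Proof. by case: z => a b; exact: sqrtr_ge0. Qed.

Lemma normcX (R : rcfType) (z : R[i]) n : normc (z ^+ n) = normc z ^+ n.
Proof. by elim: n => [|n IHn]; rewrite ?expr0 ?normc1 // !exprS normcM IHn. Qed.

Lemma normc_gt0 (R : rcfType) (z : R[i]) : (0 < normc z) = (z != 0).
Proof. by rewrite -ltcR -normr_normc normr_gt0. Qed.

Lemma normcB (R : rcfType) (x y : R[i]) : normc (x - y) = normc (y - x).
Proof. by rewrite -opprB normcN. Qed.

Lemma normcDB (R : rcfType) (y x z : R[i]) :
  normc (x - z) <= normc (x - y) + normc (y - z).
Proof. by have := le_normcD (x - y) (y - z); rewrite addrA subrK. Qed.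

Lemma normcBB (R : rcfType) (x y : R[i]) : normc x - normc y <= normc (x - y).
Proof. by have := le_normcD (x - y) y; rewrite subrK lerBlDr. Qed.

Lemma normc_real (R : rcfType) (a : R) : normc a%:C = `|a|.
Proof. by rewrite /= expr0n /= addr0 sqrtr_sqr. Qed.

Lemma normc_prod (R : rcfType) (I : Type) (s : seq I) (F : I -> R[i]) :
  normc (\prod_(i <- s) F i) = \prod_(i <- s) normc (F i).
Proof. by elim/big_rec2: _ => [|i x y _ <-]; rewrite ?normc1 ?normcM. Qed.

Lemma prodr_const_seq (A : pzSemiRingType) (I : Type) (s : seq I) (c : A) :
  \prod_(i <- s) c = c ^+ size s.
Proof. by rewrite big_const_seq count_predT iter_mulr_1. Qed.

(** * Locating roots of a polynomial from its factorization *)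

Section RootLocation.
Context (R : rcfType).
Implicit Types (F : {poly R[i]}) (x u z c : R[i]) (s : seq R[i]).

Lemma horner_factored c s z :
  (c *: \prod_(r <- s) ('X - r%:P)).[z] = c * \prod_(r <- s) (z - r).
Proof.
rewrite hornerZ horner_prod; congr (_ * _).
by apply: eq_bigr => r _; rewrite hornerXsubC.
Qed.

(** Each root contributes at most 1/d to the modulus of the logarithmic derivative at [u]. Cleared
    of denominators, this follows by induction from the product rule. *)
Lemma normc_deriv_factored s u d :
  0 < d -> (forall r, r \in s -> d <= normc (u - r)) ->
  d * normc (\prod_(r <- s) ('X - r%:P))^`().[u] <=
  (size s)%:R * normc (\prod_(r <- s) ('X - r%:P)).[u].
Proof.
move=> d0; elim: s => [|r s IHs] far /=.
  by rewrite !big_nil derivC hornerC normc0 mulr0 mul0r.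
have {}IHs := IHs (fun y ys => far y (@mem_behead _ (r :: s) y ys)).
have dr := far r (mem_head r s).
rewrite !big_cons derivM derivXsubC mul1r !hornerE.
move: IHs; set a := (\prod_(_ <- _) _).[u]; set b := (_^`()).[u] => IHs.
have := le_normcD a ((u - r) * b); rewrite !normcM -natr1.
have := normc_ge0 a; have := normc_ge0 b; have := ler0n R (size s).
move: IHs dr; move: (normc (u - r)) (normc (a + _)) => v w.
move: (normc a) (normc b) (size s)%:R => A B N IHs dv N0 B0 A0 wAB.
have v0 : 0 <= v by apply: le_trans dv; apply: ltW.
have := ler_wpM2l (ltW d0) wAB; have := ler_wpM2l v0 IHs.
by have := ler_wpM2r A0 dv; lra.
Qed.

(* [F'/F] is the sum of the [1/(u - r)] over the roots [r] of [F]. *)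
Lemma root_near_deriv F u d : 0 < d ->
  (size F).-1%:R * normc F.[u] < d * normc F^`().[u] ->
  exists2 r, root F r & normc (u - r) < d.
Proof.
move=> d0; have [s Fs] := closed_field_poly_normal F.
have [c0|c0] := eqVneq (lead_coef F) 0.
  by rewrite Fs c0 scale0r derivC horner0 normc0 !mulr0 ltxx.
have -> : (size F).-1 = size s by rewrite Fs size_scale // size_prod_XsubC.
move=> lt; have [/hasP[r rs ur]|/hasPn far] :=
    boolP (has (fun r => normc (u - r) < d) s).
  exists r => //; rewrite Fs rootZ //.
  by rewrite root_prod_XsubC.
have far' r : r \in s -> d <= normc (u - r) by move=> /far; rewrite -leNgt.
move: lt; rewrite Fs derivZ !hornerZ !normcM !(mulrCA _ (normc (lead_coef F))).
by rewrite ltr_pM2l ?normc_gt0 // ltNge normc_deriv_factored.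
Qed.

(* With [D = deg F] and [w] ranging over the [D]-th roots of unity, the product
   of the [F(x + e w)] has modulus [|c|^D] times the product, over the roots [r]
   of [F], of the [|(r - x)^D - e^D|], each at most [2 |r - x|^D] when
   [e <= |r - x|]; hence it is at most [(2 |F(x)|)^D]. *)
Lemma root_near_circle F x (e m : R) : 0 < e ->
  (forall z, normc (z - x) = e -> m <= normc F.[z]) ->
  2 * normc F.[x] < m ->
  exists2 r, root F r & normc (r - x) < e.
Proof.
move=> e0 circ Fxm; have [s Fs] := closed_field_poly_normal F.
move: (lead_coef F) Fs => c Fs.
have FE z : F.[z] = c * \prod_(r <- s) (z - r) by rewrite Fs horner_factored.
have m0 : 0 < m by apply: le_lt_trans Fxm; rewrite mulr_ge0 ?normc_ge0.
have circE w : normc w = 1 -> m <= normc F.[x + e%:C * w].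
  move=> w1; apply: circ; rewrite addrC addKr normcM normc_real w1 mulr1.
  by rewrite gtr0_norm.
have [c0|c0] := eqVneq c 0.
  have := circE 1 (normc1 _).
  by rewrite Fs c0 scale0r horner0 normc0 leNgt m0.
have [/hasP[r rs ur]|/hasPn far] :=
    boolP (has (fun r => normc (r - x) < e) s).
  by exists r => //; rewrite Fs rootZ // root_prod_XsubC.
have {}far r : r \in s -> e <= normc (r - x) by move=> /far; rewrite -leNgt.
set D := size s.
have [D0|D0] := posnP D.
  have := circE 1 (normc1 _); move: Fxm; rewrite !FE.
  rewrite (size0nil D0) !big_nil !mulr1; have := normc_ge0 c; lra.
have [t ts] := closed_field_poly_normal ('X^D - 1 : {poly R[i]}).
rewrite lead_coefXnsubC // scale1r in ts.
have st : size t = D.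
  by apply: succn_inj; rewrite -(size_prod_XsubC _ id) -ts size_XnsubC.
have t1 w : w \in t -> normc w = 1.
  move=> wt; have : root ('X^D - 1 : {poly R[i]}) w.
    by rewrite ts root_prod_XsubC.
  rewrite rootE !hornerE subr_eq0 => /eqP wD.
  apply/eqP; rewrite -(@pexpr_eq1 _ _ D) ?normc_ge0 //.
  by rewrite -normcX wD normc1.
have lo : m ^+ D <= \prod_(w <- t) normc F.[x + e%:C * w].
  rewrite -st -prodr_const_seq big_seq [leRHS]big_seq.
  by apply: ler_prod => w /t1 /circE ->; rewrite ltW.
have up : \prod_(w <- t) normc F.[x + e%:C * w] <= (2 * normc F.[x]) ^+ D.
  rewrite -normc_prod.
  rewrite (eq_bigr _ (fun w _ => FE (x + e%:C * w))).
  rewrite big_split /= prodr_const_seq exchange_big /= st normcM normcX.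
  rewrite normc_prod FE normcM normc_prod [2 * _]mulrCA exprMn.
  apply: ler_wpM2l; first by rewrite exprn_ge0 ?normc_ge0.
  rewrite exprMn -[X in X * _]prodr_const_seq -prodrXl -big_split /=.
  rewrite big_seq [leRHS]big_seq; apply: ler_prod => r /far far_r.
  rewrite normc_ge0 /=.
  (* Evaluate the factorization of X^D - 1 over [t] at (r - x)/e and multiply each factor by -e. *)
  have -> : \prod_(w <- t) (x + e%:C * w - r) =
            (- e%:C) ^+ D * (((r - x) / e%:C) ^+ D - 1).
    have -> y : y ^+ D - 1 = ('X^D - 1 : {poly R[i]}).[y] by rewrite !hornerE.
    rewrite ts horner_prod -st -prodr_const_seq -big_split /=.
    apply: eq_bigr => w _; rewrite hornerXsubC mulrBr mulNr mulrCA mulfV.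
      by ring.
    by rewrite -normc_gt0 normc_real normr_gt0 gt_eqF.
  rewrite normcM normcX normcN normc_real gtr0_norm //.
  have eD0 : 0 < e ^+ D by rewrite exprn_gt0.
  apply: le_trans (ler_wpM2l (ltW eD0) (le_normcD _ _)) _.
  rewrite normcN normc1 normcX normcM normcV normc_real gtr0_norm // expr_div_n.
  rewrite mulrDr mulrCA mulfV ?gt_eqF // !mulr1.
  have : e ^+ D <= normc (r - x) ^+ D.
    by apply: lerXn2r; rewrite ?nnegrE ?normc_ge0 ?(ltW e0).
  by rewrite (normcB x r); lra.
have : m ^+ D <= (2 * normc F.[x]) ^+ D by exact: le_trans up.
rewrite ler_pXn2r ?nnegrE ?mulr_ge0 ?normc_ge0 ?(ltW m0) // leNgt.
by rewrite Fxm.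
Qed.

End RootLocation.

(** * Elementary estimates for powers and polynomials *)

Section PolynomialEstimates.
Context (R : realType).
Implicit Types (p q : {poly R[i]}) (x y z : R[i]).

Lemma expr_small (r e : R) : 0 <= r < 1 -> 0 < e ->
  exists N, forall n, (N <= n)%N -> r ^+ n < e.
Proof.
move=> /andP[r0 r1] e0; have /cvg_expr/cvgrPdist_lt/(_ e e0)[N _ NP] : `|r| < 1.
  by rewrite ger0_norm.
by exists N => n /NP /=; rewrite sub0r normrN ger0_norm // exprn_ge0.
Qed.

Lemma expr_unbounded (a A : R) : 1 < a ->
  exists N, forall n, (N <= n)%N -> A < a ^+ n.
Proof.
move=> a1; have a0 : 0 < a by apply: lt_trans a1.
have A0 : 0 < (`|A| + 1)^-1 by rewrite invr_gt0 ltr_wpDl.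
have r1 : 0 <= a^-1 < 1 by rewrite invr_ge0 ltW //= invf_lt1.
have [N NP] := expr_small r1 A0; exists N => n /NP; rewrite exprVn.
rewrite ltf_pV2 ?posrE ?exprn_gt0 ?ltr_wpDl // => /(lt_trans _); apply.
by rewrite ltr_pwDr // ler_norm.
Qed.

Lemma normc_horner_le q : exists2 C : R, 0 <= C &
  forall z (M : R), 1 <= M -> normc z <= M -> normc q.[z] <= C * M ^+ size q.
Proof.
exists (\sum_(i < size q) normc q`_i) => [|z M M1 zM].
  by apply: sumr_ge0 => i _; exact: normc_ge0.
rewrite horner_coef mulr_suml.
apply: le_trans (_ : \sum_(i < size q) normc (q`_i * z ^+ i) <= _).
  elim/big_rec2: _ => [|i u v _ vu]; first by rewrite normc0.
  by apply: le_trans (le_normcD _ _) _; rewrite lerD2l.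
apply: ler_sum => i _; rewrite normcM normcX ler_wpM2l ?normc_ge0 //.
apply: (@le_trans _ _ (M ^+ i)).
  by apply: lerXn2r; rewrite ?nnegrE ?normc_ge0 ?(le_trans (normc_ge0 z)).
by apply: ler_weXn2l => //; exact: ltnW.
Qed.

(** By the factor theorem q(y) - q(x) = p(y)(y - x), and p is bounded on the unit disc about [x]. *)
Lemma horner_continuous_normc q x (e : R) : 0 < e -> exists2 d : R, 0 < d &
  forall y, normc (y - x) < d -> normc (q.[y] - q.[x]) < e.
Proof.
move=> e0; have /factor_theorem[p pE] : root (q - q.[x]%:P) x.
  by rewrite rootE !hornerE subrr.
have [C C0 pC] := normc_horner_le p; set M := normc x + 1.
have M1 : 1 <= M by rewrite lerDr normc_ge0.
set B := C * M ^+ size p + 1.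
have B0 : 0 < B.
  by rewrite ltr_wpDl // mulr_ge0 // exprn_ge0 // (le_trans ler01).
exists (Num.min 1 (e / B)) => [|y]; first by rewrite lt_min ltr01 divr_gt0.
rewrite lt_min ltr_pdivlMr // => /andP[yx1 yxB].
have -> : q.[y] - q.[x] = p.[y] * (y - x).
  by rewrite -(hornerXsubC x y) -hornerM -pE !hornerE.
rewrite normcM mulrC; apply: le_lt_trans yxB.
rewrite ler_wpM2l ?normc_ge0 //; apply: le_trans (pC _ M M1 _) _.
  by have := normcBB y x; rewrite /M; lra.
by rewrite lerDl.
Qed.

(** On the circle each root r gives a factor of modulus at least e: exactly e if r = x, and
    otherwise at least |r - x| - e > e, because [eta] is at most |r - x|/2. Their product is the
    bound, without compactness. *)
Lemma normc_horner_gt0_circle p x : p != 0 -> exists2 eta : R, 0 < eta &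
  forall e : R, 0 < e < eta -> exists2 d : R, 0 < d &
    forall z, normc (z - x) = e -> d <= normc p.[z].
Proof.
have [s ps] := closed_field_poly_normal p.
rewrite -lead_coef_eq0; move: (lead_coef p) ps => c -> {p} c0.
elim: s => [|r s [eta eta0 IHs]].
  exists 1 => // e _; exists (normc c); rewrite ?normc_gt0 // => z _.
  by rewrite big_nil hornerZ hornerC mulr1.
exists (if r == x then eta else Num.min eta (normc (r - x) / 2)).
  case: eqVneq => // rx; rewrite lt_min eta0 divr_gt0 // normc_gt0.
  by rewrite subr_eq0.
move=> e /andP[e0 elt].
have [d d0 dP] : exists2 d : R, 0 < d & forall z, normc (z - x) = e ->
    d <= normc (c *: \prod_(z <- s) ('X - z%:P)).[z].
  apply: IHs; rewrite e0 /=; case: eqVneq elt => // _.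
  by rewrite lt_min => /andP[].
exists (d * e) => [|z zx]; first exact: mulr_gt0.
rewrite big_cons hornerZ hornerM mulrCA -hornerZ normcM hornerXsubC.
rewrite [d * e]mulrC.
apply: ler_pM; [exact: ltW|exact: ltW| |exact: dP].
case: eqVneq elt => [->|_]; first by rewrite zx.
rewrite lt_min => /andP[_ erx].
have := normcBB (r - x) (z - x).
have -> : r - x - (z - x) = r - z by ring.
by rewrite (normcB r z) zx; lra.
Qed.

End PolynomialEstimates.

(** * Lower and upper limits of sets *)

Section PainleveKuratowski.
Context (R : realType).
Implicit Types (As : nat -> set R[i]) (A : set R[i]) (z : R[i]).
Local Open Scope ereal_scope.

Lemma dist_set_ge0 z A : 0 <= dist_set z A.
Proof.
by apply: le_ereal_inf_tmp => _ [a _ <-]; rewrite normr_normc lee_fin normc_ge0.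
Qed.

Lemma dist_set_lt z A (e : R) :
  dist_set z A < e%:E <-> exists2 a, A a & (normc (z - a) < e)%R.
Proof.
split=> [/ereal_inf_lt[_ [a Aa <-]]|[a Aa za]].
  by rewrite normr_normc lte_fin; exists a.
apply: le_lt_trans (_ : (normc (z - a))%:E < _); last by rewrite lte_fin.
by apply: ereal_inf_lbound; exists a => //; rewrite normr_normc.
Qed.

Lemma limn_esup_dist_ge0 As z : 0 <= limn_esup (fun n => dist_set z (As n)).
Proof.
apply: limf_esup_ge0 => [[N _ /(_ N)]|n]; last exact: dist_set_ge0.
by apply; exact: leqnn.
Qed.

Lemma limn_esup_le (u : nat -> \bar R) N l :
  (forall n, (N <= n)%N -> u n <= l) -> limn_esup u <= l.
Proof.
move=> ul; apply: (@le_trans _ _ (ereal_sup (u @` [set n | (N <= n)%N]))).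
  by apply: ereal_inf_lbound; exists [set n | (N <= n)%N] => //; exists N.
by apply: ge_ereal_sup => _ [n Nn <-]; exact: ul.
Qed.

(** The lower-limit arguments use this form, free of extended reals; [approached_PK_liminf] converts
    it at the end. *)
Definition approached As z := forall e : R, (0 < e)%R ->
  exists N, forall n, (N <= n)%N -> exists2 a, As n a & (normc (z - a) < e)%R.

(** Closedness of the lower limit. It reduces boundary points of K_q to points of the S_j, and zeros
    of p on the unit circle to nearby points where p does not vanish. *)
Lemma approached_closed As z :
  (forall e : R, (0 < e)%R ->
     exists2 w, approached As w & (normc (z - w) < e)%R) ->
  approached As z.
Proof.
move=> cl e e0; have e2 : (0 < e / 2)%R by rewrite divr_gt0.
have [w /(_ _ e2)[N Nw] zw] := cl _ e2; exists N => n /Nw[a Aa wa].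
by exists a => //; apply: le_lt_trans (normcDB w z a) _; lra.
Qed.

Lemma approached_PK_liminf As z : approached As z -> PK_liminf As z.
Proof.
move=> near_z; apply/eqP; rewrite eq_le limn_esup_dist_ge0 andbT.
apply/lee_addgt0Pr => e /near_z[N Ne]; rewrite add0e.
by apply: (@limn_esup_le _ N) => n /Ne /dist_set_lt /ltW.
Qed.

Lemma PK_limsup_frequently As z : PK_limsup As z ->
  forall (e : R) N, (0 < e)%R -> exists n, (N <= n)%N /\
    exists2 a, As n a & (normc (z - a) < e)%R.
Proof.
rewrite /PK_limsup /= => lim0 e N e0; apply: contrapT => far.
suff : e%:E <= 0 by rewrite lee_fin leNgt e0.
(* The lower limit is the opposite of the upper limit of the opposites, so an eventual lower bound
   passes to it through [limn_esup_le]. *)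
rewrite -lim0 leeNr; apply: (@limn_esup_le _ N) => n Nn.
rewrite leeN2 leNgt; apply/negP => /dist_set_lt near_n.
by apply: far; exists n.
Qed.

Lemma PK_liminf_subset_limsup As : PK_liminf As `<=` PK_limsup As.
Proof.
move=> z; rewrite /PK_liminf /PK_limsup /= => esup0.
apply/eqP; rewrite eq_le -{1}esup0 limn_einf_sup leeNr oppe0.
by apply: (@limn_esup_le _ 0) => n _; rewrite oppe_le0 dist_set_ge0.
Qed.

End PainleveKuratowski.

Lemma normr_lt1 (R : rcfType) (w : R[i]) : (`|w| < 1) = (normc w < 1).
Proof. by rewrite normr_normc -[1](rmorph1 (real_complex R)) ltcR. Qed.

Lemma normr_eq1 (R : rcfType) (w : R[i]) : `|w| = 1 <-> normc w = 1.
Proof. by rewrite normr_normc; split=> [[]|->]. Qed.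

(** * Escape, local convergence of iterates, and the upper limit *)

Section FilledJulia.
Context (R : realType).
Implicit Types (g : R[i] -> R[i]) (q : {poly R[i]}) (x z : R[i]).

Lemma filled_juliaP g z :
  filled_julia g z <-> exists M : R, forall k, normc (iter k g z) <= M.
Proof.
split=> -[M bM]; last by exists M%:C => k; rewrite normr_normc lecR.
exists (complex.Re M) => k; have := bM k.
by rewrite normr_normc lecE => /andP[].
Qed.

Lemma filled_julia_preim g z : filled_julia g (g z) -> filled_julia g z.
Proof.
move=> /filled_juliaP[M bM]; apply/filled_juliaP; exists (Num.max (normc z) M).
by case=> [|k]; rewrite le_max ?lexx // iterSr bM orbT.
Qed.

Lemma filled_julia_iter g j z : filled_julia g z -> filled_julia g (iter j g z).
Proof.
move=> /filled_juliaP[M bM]; apply/filled_juliaP; exists M => k.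
by rewrite -iterD.
Qed.

Lemma filled_julia_fixed g z : g z = z -> filled_julia g z.
Proof.
move=> gz; apply/filled_juliaP; exists (normc z) => k.
by rewrite iter_fix.
Qed.

(** For large n, f_n at least doubles the modulus outside the disc of radius 1 + d, so orbits
    starting there are unbounded. *)
Lemma power_plus_escape q (d : R) : 0 < d ->
  exists N, forall n, (N <= n)%N ->
  forall u, 1 + d <= normc u -> ~ filled_julia (power_plus q n) u.
Proof.
move=> d0; have [C C0 qC] := normc_horner_le q.
have d1 : 1 < 1 + d by rewrite ltrDl.
have [N NP] := expr_unbounded (C + 2) d1.
exists (N + (size q).+1)%N => n Nn u du /filled_juliaP[M bM].
have expand v : 1 + d <= normc v -> 2 * normc v <= normc (power_plus q n v).
  move=> dv; set a := normc v in dv *.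
  have a1 : 1 <= a by lra.
  have a0 : 0 <= a by lra.
  have qv := qC v a a1 (lexx _).
  (* In [C + 2], the C pays for the term q(v) and the 2 for the doubling; a^(size q + 1) dominates
     both a and a^(size q). *)
  have vn : (C + 2) * a ^+ (size q).+1 <= a ^+ n.
    rewrite -(subnK (leq_trans (leq_addl N _) Nn)) exprD.
    apply: ler_wpM2r; first exact: exprn_ge0.
    apply: (@le_trans _ _ ((1 + d) ^+ (n - (size q).+1))).
      by apply/ltW/NP; lia.
    by apply: lerXn2r; rewrite ?nnegrE //; lra.
  have := normcBB (v ^+ n) (- q.[v]); rewrite opprK normcN normcX -/a.
  rewrite -/(power_plus q n v).
  have s1 : a <= a ^+ (size q).+1.
    by rewrite exprS ler_peMr // exprn_ege1.
  have s2 : C * a ^+ size q <= C * a ^+ (size q).+1.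
    by rewrite ler_wpM2l // exprS ler_peMl // exprn_ge0.
  by lra.
have grow k : 2 ^+ k * (1 + d) <= normc (iter k (power_plus q n) u).
  elim: k => [|k IHk]; first by rewrite mul1r.
  rewrite iterS exprS -mulrA; apply: le_trans (expand _ _).
    by rewrite ler_pM2l.
  apply: le_trans IHk; rewrite ler_peMl ?exprn_ege1 ?ler1n //; lra.
have [k /(_ k (leqnn _))] := expr_unbounded M (ltr1n R 2).
apply/negP; rewrite -leNgt; apply: le_trans (bM k); apply: le_trans (grow k).
by rewrite ler_peMr ?exprn_ge0 //; lra.
Qed.

Lemma power_plus_near q x (e : R) : normc x < 1 -> 0 < e ->
  exists2 d : R, 0 < d & exists N, forall n, (N <= n)%N ->
  forall u, normc (u - x) < d -> normc (power_plus q n u - q.[x]) < e.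
Proof.
move=> x1 e0; have e2 : 0 < e / 2 by rewrite divr_gt0.
have [d d0 dP] := horner_continuous_normc q x e2.
have x0 := normc_ge0 x.
(* The midpoint of |x| and 1 bounds |u| for all [u] near [x], so u^n tends to 0 uniformly there. *)
have r01 : 0 <= (normc x + 1) / 2 < 1 by apply/andP; split; lra.
have [N NP] := expr_small r01 e2.
exists (Num.min d ((1 - normc x) / 2)); first by rewrite lt_min d0 /=; lra.
exists N => n /NP rn u; rewrite lt_min => /andP[/dP qu ux].
rewrite /power_plus -addrA; apply: le_lt_trans (le_normcD _ _) _.
rewrite normcX; have : normc u ^+ n <= ((normc x + 1) / 2) ^+ n.
  apply: lerXn2r; rewrite ?nnegrE ?normc_ge0 //; first by lra.
  by have := normcBB u x; lra.
by lra.
Qed.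

(** Only the points to which f_n is applied must lie in the open disc; the last iterate q^j(x) may
    lie outside, as the upper limit requires. *)
Lemma iter_power_plus_near q j x (e : R) : 0 < e ->
  (forall i, (i < j)%N -> normc (iter i (horner q) x) < 1) ->
  exists2 d : R, 0 < d & exists N, forall n, (N <= n)%N ->
  forall u, normc (u - x) < d ->
    normc (iter j (power_plus q n) u - iter j (horner q) x) < e.
Proof.
move=> + xj; elim: j xj e => [|j IHj] xj e e0.
  by exists e => //; exists 0.
have [d d0 [N NP]] := power_plus_near q (xj j (leqnn _)) e0.
have [|d' d'0 [N' NP']] := IHj _ d d0.
  by move=> i ij; apply: xj; exact: ltnW.
exists d' => //; exists (maxn N N') => n; rewrite geq_max => /andP[Nn Nn'] u ux.
by rewrite !iterS; apply: NP => //; exact: NP'.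
Qed.

Lemma PK_limsup_subset_K_infty q :
  PK_limsup (fun n => filled_julia (power_plus q n)) `<=` K_infty q.
Proof.
move=> z limz; apply: contrapT => nKz.
(* Take the first exit from the open disc. Its modulus is not 1, since otherwise [z] would lie in
   S_j. *)
have [j jz jmin] : exists2 j, 1 < normc (iter j (horner q) z) &
    forall i, (i < j)%N -> normc (iter i (horner q) z) < 1.
  have ex : exists j, ~~ (normc (iter j (horner q) z) < 1).
    apply: contrapT => nex; apply: nKz; left => k /=.
    by rewrite normr_lt1; apply/negPn/negP => zk; apply: nex; exists k.
  exists (ex_minn ex); case: ex_minnP => j; rewrite -leNgt => j1 jmin.
    rewrite lt_neqAle j1 andbT; apply/eqP => zj; apply: nKz; right.
    exists j => //; split=> [|i ij]; first exact/normr_eq1.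
    by rewrite normr_lt1 ltNge; apply/negP => zi; move: (jmin i);
      rewrite -leNgt leqNgt ij => /(_ zi).
  by move=> i ij; rewrite ltNge; apply/negP => zi; move: (jmin i);
      rewrite -leNgt leqNgt ij => /(_ zi).
(* Half of the excess over 1 absorbs the approximation error; the other half is the escape
   margin. *)
set h := (normc (iter j (horner q) z) - 1) / 2.
have h0 : 0 < h by rewrite /h; lra.
have [d d0 [N NP]] := iter_power_plus_near h0 jmin.
have [N' NP'] := power_plus_escape q h0.
have [n [Nn [a Ka za]]] := PK_limsup_frequently limz (maxn N N') d0.
move: Nn; rewrite geq_max => /andP[/NP/(_ a) + /NP'].
rewrite normcB => /(_ za) aj esc; apply: (esc _ _ (filled_julia_iter j Ka)).
have := normcBB (iter j (horner q) z) (iter j (power_plus q n) a).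
by rewrite normcB; move: aj; rewrite /h; lra.
Qed.

End FilledJulia.

(** * Pulling approximations back along q *)

Section Approach.
Context (R : realType).
Implicit Types (p q : {poly R[i]}) (x z : R[i]).

(** For t in K(f_n) near q(x), solutions of f_n(y) = t are roots of X^n + q - t. On a small circle
    about [x] this is close to q - q(x), which is bounded below there, so [root_near_circle]
    applies. *)
Lemma approached_preim q x : (1 < size q)%N -> normc x < 1 ->
  approached (fun n => filled_julia (power_plus q n)) q.[x] ->
  approached (fun n => filled_julia (power_plus q n)) x.
Proof.
move=> q1 x1 qx e e0; have x0 := normc_ge0 x.
have p0 : q - q.[x]%:P != 0.
  rewrite subr_eq0; apply/eqP => qc; move: q1; rewrite qc ltnNge.
  by rewrite size_polyC_leq1.
have [eta eta0 etaP] := normc_horner_gt0_circle x p0.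
(* Halving makes r < eta strict and keeps the closed disc of radius r about [x] inside the open unit
   disc. *)
set r := Num.min (Num.min e eta) ((1 - normc x)) / 2.
have r0 : 0 < r by rewrite divr_gt0 // !lt_min e0 eta0 /= subr_gt0.
have : r * 2 <= Num.min (Num.min e eta) (1 - normc x) by rewrite divfK.
rewrite !le_min => /andP[/andP[re reta] rx].
have [d d0 dP] := etaP r (ltac:(apply/andP; split; lra)).
have d8 : 0 < d / 8 by rewrite divr_gt0.
have s01 : 0 <= normc x + r < 1 by apply/andP; split; lra.
have [N NP] := expr_small s01 d8.
have [N' NP'] := qx _ d8.
exists (maxn N N') => n; rewrite geq_max => /andP[/NP sn /NP'[t Kt qxt]].
have small w : normc w <= normc x + r -> normc (w ^+ n) < d / 8.
  move=> wx; rewrite normcX; apply: le_lt_trans sn.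
  by apply: lerXn2r; rewrite ?nnegrE ?normc_ge0 //; lra.
set F := 'X^n + q - t%:P : {poly R[i]}.
have FE w : F.[w] = w ^+ n + q.[w] - t by rewrite !hornerE.
(* On the circle |F| is at least d - d/8 - d/8 = 3d/4, while 2|F(x)| < 2(d/8 + d/8) = d/2. *)
have [||y Fy yx] := @root_near_circle _ F x r (3 / 4 * d) r0.
- move=> w wx; rewrite FE.
  have := dP w wx; rewrite !hornerE => dw.
  have := small w; have := normcBB w x; rewrite wx => wx' /(_ _) wn.
  have {}wn : normc (w ^+ n) < d / 8 by apply: wn; lra.
  have := normcBB (q.[w] - q.[x]) (- (w ^+ n + (q.[x] - t))).
  have -> : q.[w] - q.[x] - - (w ^+ n + (q.[x] - t)) = w ^+ n + q.[w] - t.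
    by ring.
  by rewrite normcN; have := le_normcD (w ^+ n) (q.[x] - t); lra.
- rewrite FE -addrA; have := le_normcD (x ^+ n) (q.[x] - t).
  by have := small x (ltac:(lra)); lra.
exists y; last by rewrite normcB; lra.
apply: filled_julia_preim; rewrite (_ : power_plus _ _ _ = t) //.
by move/eqP: Fy; rewrite FE => /eqP; rewrite subr_eq0 => /eqP.
Qed.

Lemma approached_preim_iter q j z : (1 < size q)%N ->
  (forall i, (i < j)%N -> normc (iter i (horner q) z) < 1) ->
  approached (fun n => filled_julia (power_plus q n)) (iter j (horner q) z) ->
  approached (fun n => filled_julia (power_plus q n)) z.
Proof.
move=> q1; elim: j => [//|j IHj] zj zK; apply: IHj => [i ij|].
  by apply: zj; exact: ltnW.
exact: approached_preim (zj _ (leqnn _)) zK.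
Qed.

(** * The unit circle and zeros of X^n + p near it *)

Definition expi (t : R) : R[i] := cos t +i* sin t.

Lemma normc_expi t : normc (expi t) = 1.
Proof. by rewrite /= cos2Dsin2 sqrtr1. Qed.

Lemma expiD s t : expi (s + t) = expi s * expi t.
Proof. by rewrite /expi cosD sinD; simpc; congr (_ +i* _); rewrite addrC. Qed.

Lemma expiX t n : expi t ^+ n = expi (t *+ n).
Proof.
elim: n => [|n IHn]; first by rewrite /expi cos0 sin0.
by rewrite exprS IHn mulrS expiD.
Qed.

Lemma expi_2pi (k : int) : expi (pi *+ 2 *~ k) = 1.
Proof.
have natk (m : nat) : expi (pi *+ 2 *+ m) = 1.
  by rewrite -expiX {1}/expi cos2pi sin2pi expr1n.
case: k => m; first exact: natk.
rewrite NegzE mulrNz -[LHS]mulr1 -[X in _ * X](natk m.+1) -expiD addNr.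
by rewrite /expi cos0 sin0.
Qed.

Lemma expi_surj z : normc z = 1 -> exists t, z = expi t.
Proof.
case: z => a b /= ab1; have {}ab1 : a ^+ 2 + b ^+ 2 = 1.
  by rewrite -[LHS]sqr_sqrtr ?addr_ge0 ?sqr_ge0 // ab1 expr1n.
have a1 : -1 <= a <= 1.
  by have b2 := sqr_ge0 b; apply/andP; split; nra.
have sa : sin (acos a) = `|b|.
  by rewrite sin_acos // -ab1 [_ + b ^+ 2]addrC addrK sqrtr_sqr.
have [b0|b0] := leP 0 b.
  by exists (acos a); rewrite /expi acosK ?in_itv //= sa ger0_norm.
exists (- acos a); rewrite /expi cosN sinN acosK ?in_itv //= sa.
by rewrite ltr0_norm ?opprK.
Qed.

Lemma expi_continuous t (e : R) : 0 < e -> exists2 d : R, 0 < d &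
  forall s, `|t - s| < d -> normc (expi t - expi s) < e.
Proof.
move=> e0; have e2 : 0 < e / 2 by rewrite divr_gt0.
have /cvgrPdist_lt/(_ _ e2)/nbhs_ballP[d1 d10 d1P] := @continuous_cos R t.
have /cvgrPdist_lt/(_ _ e2)/nbhs_ballP[d2 d20 d2P] := @continuous_sin R t.
exists (Num.min d1 d2) => [|s]; first by rewrite lt_min d10.
rewrite lt_min => /andP[/d1P c /d2P s']; rewrite /= in c s'.
have -> : expi t - expi s = (cos t - cos s)%:C + 'i * (sin t - sin s)%:C.
  by rewrite /expi; simpc.
apply: le_lt_trans (le_normcD _ _) _; rewrite normcM !normc_real.
rewrite [X in X * _](_ : _ = 1) ?mul1r; first by lra.
by rewrite /= expr0n /= add0r expr1n sqrtr1.
Qed.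

(** The n-th roots of c have modulus |c|^(1/n), which tends to 1, and arguments spaced by 2 pi/n. *)
Lemma root_of_unit_circle z c (e : R) : normc z = 1 -> c != 0 -> 0 < e ->
  exists N, forall n, (N <= n)%N -> exists2 u, u ^+ n = c & normc (z - u) < e.
Proof.
move=> z1 c0 e0; have [t zt] := expi_surj z1.
have nc0 : 0 < normc c by rewrite normc_gt0.
have [s cs] : exists s, c = (normc c)%:C * expi s.
  have [|s cs] := @expi_surj (c / (normc c)%:C).
    by rewrite normcM normcV normc_real gtr0_norm // divff ?gt_eqF.
  exists s; rewrite -cs mulrCA divff ?mulr1 //.
  by rewrite -normc_gt0 normc_real normr_gt0 gt_eqF.
have e2 : 0 < e / 2 by rewrite divr_gt0.
have [d d0 dP] := expi_continuous t e2.
have /cvgrPdist_lt/(_ _ e2)/nbhs_ballP[d' /= d'0 d'P] := @continuous_expR R 0.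
have pi0 : 0 < pi *+ 2 :> R by rewrite pmulrn_lgt0 // pi_gt0.
set l := ln (normc c).
exists (maxn 1 (maxn (Num.bound (pi *+ 2 / d)) (Num.bound (`|l| / d')))) => n.
rewrite !geq_max => /and3P[n0 n1 n2].
have {}n0 : 0 < n%:R :> R by rewrite ltr0n.
have {}n1 : pi *+ 2 < d * n%:R.
  rewrite mulrC -ltr_pdivrMr //; apply: (lt_le_trans (archi_boundP _)).
    by rewrite divr_ge0 // ltW.
  by rewrite ler_nat.
have {}n2 : `|l| < d' * n%:R.
  rewrite mulrC -ltr_pdivrMr //; apply: (lt_le_trans (archi_boundP _)).
    by rewrite divr_ge0 // ltW.
  by rewrite ler_nat.
(* This choice puts the argument [th] of the root within 2 pi/n of [t]. *)
set k := Num.floor ((t * n%:R - s) / (pi *+ 2)).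
set th := (s + pi *+ 2 *~ k) / n%:R.
exists ((expR (l / n%:R))%:C * expi th).
  rewrite exprMn expiX -rmorphXn /= -expRM_natr.
  rewrite divfK ?gt_eqF // lnK ?posrE // [RHS]cs; congr (_ * _).
  by rewrite -mulr_natr divfK ?gt_eqF // expiD expi_2pi mulr1.
have -> : z - (expR (l / n%:R))%:C * expi th =
    (expi t - expi th) + (1 - expR (l / n%:R))%:C * expi th.
  by rewrite rmorphB rmorph1 zt; ring.
apply: le_lt_trans (le_normcD _ _) _.
rewrite normcM normc_expi mulr1 normc_real.
have : normc (expi t - expi th) < e / 2.
  apply: dP; rewrite -(ltr_pM2r n0); apply: le_lt_trans n1.
  rewrite -[X in _ * X]ger0_norm ?(ltW n0) // -normrM mulrBl divfK ?gt_eqF //.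
  have /andP[] := floor_itv ((t * n%:R - s) / (pi *+ 2)).
  rewrite -/k ler_pdivlMr // ltr_pdivrMr // intrD mulrDl mul1r.
  rewrite -[pi *+ 2 *~ k]mulrzr.
  by rewrite [pi *+ 2 * _]mulrC ler_norml; move=> *; apply/andP; split; lra.
have : `|expR 0 - expR (l / n%:R)| < e / 2.
  apply: d'P; rewrite /ball /= sub0r normrN normrM normfV.
  by rewrite ltr_pdivrMr ?normr_gt0 ?gt_eqF // [`|n%:R|]ger0_norm // ltW.
by rewrite expR0; lra.
Qed.

(** The factor (1 + it)/(1 - it) is unimodular and moves [z] by 2t/|1 - it|, which is positive and
    at most 2t = e/2. *)
Lemma unit_circle_neighbor z (e : R) : normc z = 1 -> 0 < e ->
  exists2 w, normc w = 1 & 0 < normc (w - z) < e.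
Proof.
move=> z1 e0; set t := e / 4; have t0 : 0 < t by rewrite /t; lra.
set a := (1 +i* t : R[i]); set b := (1 -i* t : R[i]).
have ab : normc a = normc b by rewrite /= sqrrN.
have b1 : 1 <= normc b.
  by rewrite /= -[leLHS]sqrtr1 ler_wsqrtr // expr1n lerDl sqr_ge0.
have b0 : b != 0 by rewrite -normc_gt0; lra.
exists (z * (a / b)).
  by rewrite normcM z1 normcM normcV ab divff ?mulr1 // gt_eqF //; lra.
have -> : z * (a / b) - z = z * ((a - b) / b).
  by rewrite mulrBl divff // mulrBr mulr1.
rewrite normcM z1 mul1r normcM normcV.
have -> : normc (a - b) = 2 * t.
  have -> : a - b = 'i * (2 * t)%:C.
    by rewrite /a /b; simpc; congr (_ +i* _); ring.
  rewrite normcM normc_real ger0_norm; last by lra.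
  by rewrite /= expr0n /= add0r expr1n sqrtr1 mul1r.
apply/andP; split; first by rewrite divr_gt0 //; lra.
rewrite ltr_pdivrMr; last by lra.
by have := ler_wpM2l (ltW e0) b1; rewrite /t; lra.
Qed.

(* Take [u] near [z] with [u^n = - p(z)].  Then [F = X^n + p] satisfies
   [F(u) = p(u) - p(z)], which is small, while [F'(u)] has order [n]. *)
Lemma root_near_unit_circle p z (e : R) : normc z = 1 -> p.[z] != 0 -> 0 < e ->
  exists N, forall n, (N <= n)%N ->
    exists2 r, r ^+ n + p.[r] = 0 & normc (z - r) < e.
Proof.
move=> z1 pz0 e0; set c := p.[z].
have c0 : 0 < normc c by rewrite normc_gt0.
set d := e / 2; have d0 : 0 < d by rewrite /d; lra.
have [d1 d10 d1P] := horner_continuous_normc p z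
  (ltac:(rewrite divr_gt0 // mulr_gt0 //) : 0 < d * normc c / 4).
set d2 := Num.min d (Num.min d1 1).
have d20 : 0 < d2 by rewrite !lt_min d0 d10 ltr01.
have mc0 : - c != 0 by rewrite oppr_eq0.
have [N1 N1P] := root_of_unit_circle z1 mc0 d20.
have [C C0 CP] := normc_horner_le p^`().
set B := C * 2 ^+ size p^`().
have B0 : 0 <= B by rewrite mulr_ge0 // exprn_ge0.
exists (maxn N1 (maxn (size p).+1 (Num.bound (4 * B / normc c)))) => n.
rewrite !geq_max => /and3P[/N1P[u un zu] np nB].
have {}nB : 4 * B <= n%:R * normc c.
  rewrite -ler_pdivrMr //; apply/ltW.
  apply: (lt_le_trans (archi_boundP _)); last by rewrite ler_nat.
  by rewrite divr_ge0 ?mulr_ge0 // ltW.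
have n0 : 0 < n%:R :> R by rewrite ltr0n; lia.
move: zu; rewrite normcB !lt_min => /and3P[uz /d1P pu u1].
have u2 : normc u <= 2 by have := normcBB u z; rewrite z1; lra.
set F := 'X^n + p : {poly R[i]}.
have pn : (size p < size ('X^n : {poly R[i]}))%N.
  by rewrite size_polyXn ltnS ltnW.
have sF : (size F).-1 = n by rewrite (size_polyDl pn) size_polyXn.
have Fu : F.[u] = p.[u] - c by rewrite !hornerE un addrC.
(* Multiplication by u turns n u^(n-1) into n u^n = -n c. *)
have F'u : u * F^`().[u] = u * p^`().[u] - n%:R * c.
  rewrite derivD derivXn hornerD hornerMn hornerXn mulrDr mulrnAr -exprS.
  by rewrite prednK -?(ltr0n R) // un -mulr_natl mulrN addrC.
(* Since |u| <= 2 and 4B <= n|c|, 2|F'(u)| >= n|c| - 2B >= n|c|/2. This is why p(u) was kept within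
   d|c|/4 of c. *)
have F'lo : n%:R * normc c <= 4 * normc F^`().[u].
  have := normcBB (n%:R * c) (u * p^`().[u]).
  rewrite normcB -F'u !normcM.
  have -> : normc (n%:R : R[i]) = n%:R.
    by rewrite -(rmorph_nat (real_complex R)) normc_real normr_nat.
  have := CP u 2 (ltac:(lra)) u2; rewrite -/B => p'u.
  have := ler_wpM2r (normc_ge0 p^`().[u]) u2.
  by have := ler_wpM2r (normc_ge0 F^`().[u]) u2; lra.
have [||r Fr ur] := @root_near_deriv _ F u d.
- exact: d0.
- rewrite sF Fu; have := ler_wpM2l (ltW d0) F'lo.
  by move: pu; rewrite -(ltr_pM2l n0); lra.
exists r; first by move/eqP: Fr; rewrite !hornerE.
apply: le_lt_trans (normcDB u z r) _.
by rewrite (normcB z u); rewrite /d in uz ur; lra.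
Qed.

(** If p(z) = 0, the previous lemma does not apply at [z], but zeros of p are isolated, so it
    applies at points of the circle arbitrarily close to [z]. *)
Lemma unit_circle_approached_roots p z : p != 0 -> normc z = 1 ->
  approached (fun n => [set r | r ^+ n + p.[r] = 0]) z.
Proof.
move=> p0 z1; apply: approached_closed => e e0.
have [eta eta0 etaP] := normc_horner_gt0_circle z p0.
have m0 : 0 < Num.min e eta by rewrite lt_min e0.
have [w w1] := unit_circle_neighbor z1 m0.
rewrite lt_min => /and3P[zw zwe zweta].
exists w; last by rewrite normcB.
have [d d0 /(_ w erefl) pw] := etaP _ (introT andP (conj zw zweta)).
move=> e' e'0; apply: root_near_unit_circle => //.
by rewrite -normc_gt0; apply: lt_le_trans pw.
Qed.

(* A zero of [X^n + q - X] is a fixed point of [f_n]; for [q = X] use instead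
   the zeros of [f_n], which are preimages of the fixed point [0]. *)
Lemma unit_circle_approached q z : normc z = 1 ->
  approached (fun n => filled_julia (power_plus q n)) z.
Proof.
move=> z1 e e0; have [qX|qX] := eqVneq q 'X.
  have X0 : 'X != 0 :> {poly R[i]} by rewrite -size_poly_eq0 size_polyX.
  have [N NP] := unit_circle_approached_roots X0 z1 e0.
  exists (maxn 1 N) => n; rewrite geq_max => /andP[n0 /NP[r /= r0 zr]].
  exists r => //; apply: filled_julia_preim.
  rewrite /power_plus qX r0; apply: filled_julia_fixed.
  by rewrite hornerX addr0 expr0n gtn_eqF.
have pX : q - 'X != 0 by rewrite subr_eq0.
have [N NP] := unit_circle_approached_roots pX z1 e0.
exists N => n /NP[r /= r0 zr]; exists r => //; apply: filled_julia_fixed.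
by apply/eqP; rewrite -subr_eq0 /power_plus -addrA -r0 !hornerE.
Qed.

(** For constant q the S_j with j > 0 are empty unless |q| = 1, when S_1 is the whole open disc.
    That case is excluded: for q = 1, points near 0 escape under z^n + 1. *)
Lemma S_approached q j z : (forall c : R[i], `|c| = 1 -> q <> c%:P) ->
  S_ q j z -> approached (fun n => filled_julia (power_plus q n)) z.
Proof.
move=> qc [zj1 zj]; have [q1|q1] := ltnP 1 (size q).
  apply: (@approached_preim_iter q j) => // [i /zj|].
    by rewrite normr_lt1.
  by apply: unit_circle_approached; exact/normr_eq1.
case: j zj1 zj => [|j] zj1 _.
  by apply: unit_circle_approached; exact/normr_eq1.
have qE := size1_polyC q1; case: (qc _ _ qE).
by move: zj1; rewrite iterS qE hornerC coefC.
Qed.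

(** * The boundary of K_q *)

Lemma iter_horner_continuous_normc q j x (e : R) : 0 < e ->
  exists2 d : R, 0 < d & forall y, normc (y - x) < d ->
    normc (iter j (horner q) y - iter j (horner q) x) < e.
Proof.
elim: j e => [|j IHj] e e0; first by exists e.
have [d d0 dP] := horner_continuous_normc q (iter j (horner q) x) e0.
by have [d' d'0 d'P] := IHj d d0; exists d' => // y /d'P /dP.
Qed.

(** Strong induction on an index j with |q^j| >= 1 somewhere on the segment. The intermediate value
    theorem gives a point where |q^j| = 1; either it lies in S_j, or an earlier iterate has modulus
    at least 1 there and the index drops. *)
Lemma K_segment_meets_S q a b : K_ q a -> ~ K_ q b ->
  exists2 c : R, 0 <= c <= 1 & exists j, S_ q j (a + c%:C * (b - a)).
Proof.
move=> Ka /existsNP[j0 /negP bj0].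
pose g j (t : R) := normc (iter j (horner q) (a + t%:C * (b - a))).
have gcont j : continuous (g j).
  move=> t; apply/cvgrPdist_lt => e e0.
  have [d d0 dP] :=
    iter_horner_continuous_normc q j (a + t%:C * (b - a)) e0.
  have k0 : 0 < normc (b - a) + 1 by rewrite ltr_wpDl ?normc_ge0.
  apply/nbhs_ballP; exists (d / (normc (b - a) + 1)); first exact: divr_gt0.
  move=> s; rewrite /ball /= ltr_pdivlMr // => ts.
  have /dP : normc (a + s%:C * (b - a) - (a + t%:C * (b - a))) < d.
    have -> : a + s%:C * (b - a) - (a + t%:C * (b - a)) = (s - t)%:C * (b - a).
      by rewrite rmorphB; ring.
    rewrite normcM normc_real distrC; apply: le_lt_trans ts.
    by rewrite ler_wpM2l // lerDl.
  apply: le_lt_trans; rewrite ler_norml /g.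
  set u := iter _ _ _; set v := iter _ _ _.
  by have := normcBB u v; have := normcBB v u; rewrite (normcB v u) => *;
    apply/andP; split; lra.
suff IH j (t : R) : 0 <= t <= 1 -> 1 <= g j t ->
    exists2 c : R, 0 <= c <= 1 & exists j, S_ q j (a + c%:C * (b - a)).
  apply: (IH j0 1); first by rewrite ler01 lexx.
  by move: bj0; rewrite /g mul1r addrC subrK normr_lt1 leNgt.
elim/ltn_ind: j t => j IHj t /andP[t0 t1] gjt.
have gj0 : g j 0 < 1.
  by have := Ka j; rewrite normr_lt1 /g mul0r addr0.
have [||c] := @IVT R (g j) 0 t 1 t0.
- exact: continuous_subspaceT.
- by rewrite ge_min le_max gjt (ltW gj0) orbT.
rewrite in_itv /= => /andP[c0 ct] gc.
have c01 : 0 <= c <= 1 by rewrite c0 (le_trans ct).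
have [[i [ij gi]]|nex] := pselect (exists i, (i < j)%N /\ 1 <= g i c).
  exact: IHj gi.
exists c => //; exists j; split=> [|i ij]; first exact/normr_eq1.
by rewrite normr_lt1 ltNge; apply/negP => gi; apply: nex; exists i.
Qed.

Lemma frontier_K_meets_S q z (e : R) : frontier (K_ q) z -> 0 < e ->
  exists2 w, exists j, S_ q j w & normc (z - w) < e.
Proof.
move=> [clz niz] e0; have eC : 0 < e%:C :> R[i] by rewrite ltcR.
have ballE w : ball (z : R[i]^o) e%:C w -> normc (z - w) < e.
  by rewrite /ball /= normr_normc ltcR.
have [a [Ka /ballE za]] := clz _ (nbhsx_ballx (z : R[i]^o) _ eC).
have [b nKb zb] : exists2 b, ~ K_ q b & normc (z - b) < e.
  apply: contrapT => nex; apply: niz; apply/nbhs_ballP; exists e%:C => //.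
  by move=> w /ballE zw; apply: contrapT => nKw; apply: nex; exists w.
have [c /andP[c0 c1] Sc] := K_segment_meets_S Ka nKb.
exists (a + c%:C * (b - a)) => //.
have -> : z - (a + c%:C * (b - a)) = (1 - c)%:C * (z - a) + c%:C * (z - b).
  by rewrite rmorphB rmorph1; ring.
apply: le_lt_trans (le_normcD _ _) _; rewrite !normcM !normc_real.
rewrite !ger0_norm ?subr_ge0 //.
(* Strictness below comes from the term in [b], whose weight c must be positive. *)
have [->|cn0] := eqVneq c 0; first by rewrite subr0 mul0r mul1r addr0.
have {}c0 : 0 < c by rewrite lt_def cn0.
have := ler_wpM2l (_ : 0 <= 1 - c) (ltW za); rewrite subr_ge0 => /(_ c1).
by have := ltr_pM2l c0 (normc (z - b)) e; rewrite zb; lra.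
Qed.

End Approach.

Theorem theorem1p4 (R : realType) (q : {poly R[i]}) :
  let K := fun n : nat => filled_julia (power_plus q n) in
  [/\ PK_limsup K `<=` K_infty q,
      PK_liminf K `<=` PK_limsup K &
      (forall c : R[i], `|c| = 1 -> q <> c%:P) ->
      frontier (K_ q) `|` \bigcup_j S_ q j `<=` PK_liminf K].
Proof.
split; [exact: PK_limsup_subset_K_infty|exact: PK_liminf_subset_limsup|].
move=> qc z zS; apply: approached_PK_liminf; case: zS => [fz|[j _ Sz]].
  apply: approached_closed => e /(frontier_K_meets_S fz)[w [j Sw] zw].
  by exists w => //; exact: S_approached Sw.
exact: S_approached Sz.
Qed.
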